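(* Let $X=(X_n:n\ge 0)$ be an irreducible recurrent Markov chain on a countable discrete state space $S$ with one-step transition matrix $P=(P(x,y):x,y\in S)$, let $K\subseteq S$ be finite, let $z\in K$, and let $A\subseteq S$ be a finite set with $K\subseteq A$. Let $q:S\to\mathbb{R}_+$, and suppose there exist $v:S\to\mathbb{R}_+$ and $c<\infty$ such that $$(Pv)(x)\le v(x)-q(x)+c\,I(x\in K)\quad\text{for all }x\in S.$$ Let $G$, $\xi$, $\|\cdot\|_{\tilde K}$, $\underline{\kappa}(\cdot,q)$ and $\overline{\kappa}(\cdot,q)$ be as defined in the context (from $P,K,z,A,q,v$). If $\|(I-G)^{-1}\xi\|_{\tilde K}<1$, then for every $x\in A-\{z\}$, $$\underline{\kappa}(x,q)\le \mathbb{E}_x\sum_{j=0}^{\tau(z)-1}q(X_j)\le \overline{\kappa}(x,q).$$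
   Context: $\mathbb{P}_x,\mathbb{E}_x$ denote probability and expectation conditional on $X_0=x$; functions are column vectors; $\tau(z)=\inf\{n\ge 1:X_n=z\}$. Put $A'=A-K$, $\tilde K=K-\{z\}$, and $A^c=S-A$. Partition $P$ according to $(K,A',A^c)$ into blocks $P_{ij}$, $1\le i,j\le 3$ (so $P_{12}$ is the $K\times A'$ block, $P_{22}$ the $A'\times A'$ block, $P_{21}$ the $A'\times K$ block, $P_{13}$ the $K\times A^c$ block, $P_{23}$ the $A'\times A^c$ block), and correspondingly let $q_1,q_2,q_3$ and $v_1,v_2,v_3$ be the restrictions of $q$ and $v$ to $K,A',A^c$. The inverse $(I-P_{22})^{-1}=\sum_{n\ge 0}P_{22}^n$ exists by irreducibility. For a function $\rho$ on $\tilde K$, $\|\rho\|_{\tilde K}=\max\{|\rho(x)|:x\in\tilde K\}$ (taken to be $0$ if $\tilde K=\emptyset$). Definitions: - $G=(G(x,y):x,y\in\tilde K)$ with $G(x,y)=P(x,y)+(P_{12}(I-P_{22})^{-1}P_{21})(x,y)$; the inverse $(I-G)^{-1}=\sum_{n\ge0}G^n$ exists and is non-negative. - $k(x,q)=q_1(x)+(P_{12}(I-P_{22})^{-1}q_2)(x)$ for $x\in K$, and $k(x,q)=((I-P_{22})^{-1}q_2)(x)$ for $x\in A'$. - $\tilde k'(x,q)=(P_{13}v_3)(x)+(P_{12}(I-P_{22})^{-1}P_{23}v_3)(x)$ for $x\in K$, and $\tilde k'(x,q)=((I-P_{22})^{-1}P_{23}v_3)(x)$ for $x\in A'$. - $\beta(x,q)=k(x,q)+\tilde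 k'(x,q)$ for $x\in A$. - $\xi(x)=1-\sum_{y\in K}\big[P(x,y)+(P_{12}(I-P_{22})^{-1}P_{21})(x,y)\big]$ for $x\in\tilde K$, and $\xi(x)=1-\sum_{y\in K}((I-P_{22})^{-1}P_{21})(x,y)$ for $x\in A'$. Equivalently $\xi(x)=\mathbb{P}_x(T<T_K)$, where $T=\inf\{n\ge0:X_n\in A^c\}$ and $T_K=\inf\{n\ge1:X_n\in K\}$. In expressions such as $(I-G)^{-1}\xi$, $\xi$ is the vector $(\xi(x):x\in\tilde K)$; likewise $\beta(q)=(\beta(x,q):x\in\tilde K)$ and $k(q)=(k(x,q):x\in\tilde K)$. - Lower bound: $\underline{\kappa}(q)=(I-G)^{-1}k(q)$ on $\tilde K$, with entries $\underline{\kappa}(x,q)$, and for $x\in A'$, $\underline{\kappa}(x,q)=k(x,q)+\sum_{y\in\tilde K}((I-P_{22})^{-1}P_{21})(x,y)\,\underline{\kappa}(y,q)$. - Upper bound: on $\tilde K$, $\overline{\kappa}(q)=(I-G)^{-1}\beta(q)+(I-G)^{-1}\xi\;\dfrac{\|(I-G)^{-1}\beta(q)\|_{\tilde K}}{1-\|(I-G)^{-1}\xi\|_{\tilde K}}$, with entries $\overline{\kappa}(x,q)$, and for $x\in A'$, $\overline{\kappa}(x,q)=\beta(x,q)+\sum_{y\in\tilde K}((I-P_{22})^{-1}P_{21})(x,y)\,\overline{\kappa}(y,q)+\xi(x)\,\|\overline{\kappa}(q)\|_{\tilde K}$. *)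

(* Defs.v *)
From HB Require Import structures.
From mathcomp Require Import all_boot all_order all_algebra finmap.
From mathcomp Require Import all_classical all_reals all_analysis.

Set Implicit Arguments.
Unset Strict Implicit.
Unset Printing Implicit Defensive.

Import Order.TTheory GRing.Theory Num.Theory.

Local Open Scope classical_set_scope.
Local Open Scope ring_scope.

(** * Markov chains on a countable discrete state space *)

Definition stochastic (R : realType) (S : countType) (P : S -> S -> R) : Prop :=
  (forall x y, 0 <= P x y) /\
  (forall x, (\esum_(y in [set: S]) (P x y)%:E = 1)%E).

(* [Pr x] is the law of the chain conditional on [X 0 = x]; [S] carries the
   discrete sigma-algebra.  The last field is the Markov property
   P_x(X_{n+1} = y | X_0 = s 0, ..., X_n = s n) = P (s n) y
   multiplied by the probability of the conditioning event. *)
Record markov_chain (R : realType) (S : countType) (P : S -> S -> R)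
    (d : measure_display) (Omega : measurableType d)
    (Pr : S -> probability Omega R) (X : nat -> Omega -> S) : Prop := {
  mc_stochastic : stochastic P ;
  mc_measurable : forall n (B : set S), measurable (X n @^-1` B) ;
  mc_init : forall x, Pr x [set w | X 0%N w = x] = 1%E ;
  mc_markov : forall x n (s : nat -> S) (y : S),
    Pr x [set w | (forall i, (i <= n)%N -> X i w = s i) /\ X n.+1 w = y] =
    (Pr x [set w | forall i, (i <= n)%N -> X i w = s i] * (P (s n) y)%:E)%E }.

Definition irreducible_chain (R : realType) (S : countType)
    (d : measure_display) (Omega : measurableType d)
    (Pr : S -> probability Omega R) (X : nat -> Omega -> S) : Prop :=
  forall x y, exists n, (0 < Pr x [set w | X n w = y])%E.

(* tau(z), with value +oo when z is never visited at a positive time *)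
Definition return_time (R : realType) (S : countType) (Omega : Type)
    (X : nat -> Omega -> S) (z : S) (w : Omega) : \bar R :=
  ereal_inf [set (n%:R)%:E | n in [set n | (1 <= n)%N /\ X n w = z]].

Definition recurrent_chain (R : realType) (S : countType)
    (d : measure_display) (Omega : measurableType d)
    (Pr : S -> probability Omega R) (X : nat -> Omega -> S) : Prop :=
  forall x, Pr x [set w | (return_time R X x w < +oo)%E] = 1%E.

Definition expected_cost (R : realType) (S : countType)
    (d : measure_display) (Omega : measurableType d)
    (Pr : S -> probability Omega R) (X : nat -> Omega -> S)
    (z : S) (q : S -> R) (x : S) : \bar R :=
  (\int[Pr x]_w
     \sum_(0 <= j <oo | (j%:R)%:E < return_time R X z w) (q (X j w))%:E)%E.

(* (P f)(x) with the sum restricted to y in B, for nonnegative P and f *)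
Definition kernel_sum (R : realType) (S : countType) (P : S -> S -> R)
    (B : set S) (f : S -> R) (x : S) : \bar R :=
  (\esum_(y in B) (P x y * f y)%:E)%E.

(** * Finite blocks of S-indexed matrices and vectors *)

(* Rows and columns of the blocks are numbered by [enum_val]/[enum_rank] of the
   finite type attached to the finite set. *)
Definition block (R : realType) (S : countType) (B C : {fset S})
    (M : S -> S -> R) : 'M[R]_(#|{: B}|, #|{: C}|) :=
  \matrix_(i, j) M (val (enum_val i)) (val (enum_val j)).

Definition restr (R : realType) (S : countType) (B : {fset S})
    (f : S -> R) : 'cV[R]_#|{: B}| :=
  \col_i f (val (enum_val i)).

(* entry of a B x C block at (x, y); the value 0 outside B x C is never used *)
Definition entry (R : realType) (S : countType) (B C : {fset S})
    (M : 'M[R]_(#|{: B}|, #|{: C}|)) (x y : S) : R :=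
  match (insub x : option B), (insub y : option C) with
  | Some b, Some c => M (enum_rank b) (enum_rank c)
  | _, _ => 0
  end.

Definition centry (R : realType) (S : countType) (B : {fset S})
    (u : 'cV[R]_#|{: B}|) (x : S) : R :=
  if (insub x : option B) is Some b then u (enum_rank b) 0 else 0.

Definition max_norm (R : realType) (n : nat) (u : 'cV[R]_n) : R :=
  \big[Num.max/0]_i `|u i 0|.

(** * The truncation bounds *)

Section Bounds.
Context (R : realType) (S : countType) (P : S -> S -> R).
Context (K : {fset S}) (z : S) (A : {fset S}) (q v : S -> R).

Local Notation A' := (A `\` K)%fset.
Local Notation Kt := (K `\ z)%fset.
Local Notation P12 := (block K A' P).
Local Notation P21 := (block A' K P).
Local Notation P22 := (block A' A' P).

(* (I - P22)^-1 *)
Definition N22 : 'M[R]_#|{: A'}| := invmx (1%:M - P22).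

Definition Gker (x y : S) : R := P x y + entry (P12 *m N22 *m P21) x y.

(* (I - G)^-1, where G is indexed by K - {z} *)
Definition Ginv : 'M[R]_#|{: Kt}| := invmx (1%:M - block Kt Kt Gker).

Definition k_fun (x : S) : R :=
  if x \in K then q x + centry (P12 *m N22 *m restr A' q) x
  else centry (N22 *m restr A' q) x.

(* x |-> sum over y outside A of P(x, y) v(y); its restrictions to K and A' are
   P13 v3 and P23 v3.  The drift condition makes the sum finite. *)
Definition Pv3 (x : S) : R := fine (kernel_sum P [set y | y \notin A] v x).

Definition ktilde_fun (x : S) : R :=
  if x \in K then Pv3 x + centry (P12 *m N22 *m restr A' Pv3) x
  else centry (N22 *m restr A' Pv3) x.

Definition betaq (x : S) : R := k_fun x + ktilde_fun x.

Definition xi_fun (x : S) : R :=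
  if x \in K then 1 - \sum_(y <- K) (P x y + entry (P12 *m N22 *m P21) x y)
  else 1 - \sum_(y <- K) entry (N22 *m P21) x y.

Definition norm_Ginv_xi : R := max_norm (Ginv *m restr Kt xi_fun).

Definition kappa_lower_vec : 'cV[R]_#|{: Kt}| := Ginv *m restr Kt k_fun.

Definition kappa_lower (x : S) : R :=
  if x \in Kt then centry kappa_lower_vec x
  else k_fun x + \sum_(y <- Kt) entry (N22 *m P21) x y * centry kappa_lower_vec y.

Definition kappa_upper_vec : 'cV[R]_#|{: Kt}| :=
  Ginv *m restr Kt betaq +
  (max_norm (Ginv *m restr Kt betaq) / (1 - norm_Ginv_xi)) *:
    (Ginv *m restr Kt xi_fun).

Definition kappa_upper (x : S) : R :=
  if x \in Kt then centry kappa_upper_vec x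
  else betaq x
    + \sum_(y <- Kt) entry (N22 *m P21) x y * centry kappa_upper_vec y
    + xi_fun x * max_norm kappa_upper_vec.

End Bounds.

(* Main.v *)
Require Import Defs.
From HB Require Import structures.
From mathcomp Require Import all_boot all_order all_algebra finmap.
From mathcomp Require Import all_classical all_reals all_analysis.
From mathcomp Require Import measurable_realfun ring lra.

(** Let [W n] be the expected cost accumulated at the times [j < n] that precede
    the return to [z].  It satisfies [W 0 = 0] and the first-step equation
    [W n.+1 = q + Pz (W n)], where [Pz] is [P] with the column [z] removed, and
    increases to the expected cost [w] ([expected_cost_series], a consequence of
    the Markov property).  By the drift condition every [W n] is finite
    ([truncated_cost_le_drift]).

    Upper bound.  Let [m] be the maximum of [W n] on [K - {z}].  The drift
    condition gives [W n <= v + m] outside [z] ([truncated_cost_le_off]), so that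
    on [A - {z}] the function [W n] is a subsolution of a finite linear system
    with source [q + P13 v3 + m P(., A^c)] ([truncated_cost_sub]).  Eliminating
    [A - K] gives [W n <= beta + m xi + G (W n)] on [K - {z}], hence
    [W n <= (I - G)^-1 beta + m (I - G)^-1 xi].  Taking norms and using that the
    norm of [(I - G)^-1 xi] is less than one bounds [m], and the bound for [W n]
    follows ([le_kappa_upper]); it does not depend on [n], so [w] is finite on
    [A - {z}] and satisfies the same bound.

    Lower bound.  Discarding the contribution of the states outside [A] in the
    first-step equation makes [w] a supersolution of the system with source [q],
    and the same elimination gives [kappa_lower <= w] ([kappa_lower_le]).

    The eliminations and inversions rest on one tool, the maximum principle
    ([max_principle]): if [f >= P f] on a finite set that avoids [z], with [P]
    restricted to this set, then [f >= 0] there.  It follows from irreducibility, as the set where a negative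
    minimum is attained would be closed ([max_principle_irreducible]); it passes
    to the kernel [G] ([max_principle_Gker]), and yields at once the
    invertibility of [I - P22] and [I - G] and the monotonicity of their
    inverses. *)

Set Implicit Arguments.
Unset Strict Implicit.
Unset Printing Implicit Defensive.

Import Order.TTheory GRing.Theory Num.Theory.
Import numFieldNormedType.Exports.

Local Open Scope classical_set_scope.
Local Open Scope ring_scope.

(** * Finite blocks and the maximum principle *)

Section Blocks.
Context (R : realType) (S : countType).
Implicit Types (B C : {fset S}) (f g h : S -> R) (M : S -> S -> R).

Lemma centry_val B (u : 'cV[R]_#|{: B}|) i : centry u (val (enum_val i)) = u i 0.
Proof. by rewrite /centry valK enum_valK. Qed.

Lemma entry_val B C (N : 'M[R]_(#|{: B}|, #|{: C}|)) i j :
  entry N (val (enum_val i)) (val (enum_val j)) = N i j.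
Proof. by rewrite /entry !valK !enum_valK. Qed.

Lemma fset_enum_val B x : x \in B -> exists i : 'I_#|{: B}|, x = val (enum_val i).
Proof. by move=> xB; exists (enum_rank [` xB]%fset); rewrite enum_rankK. Qed.

Lemma sum_fset_enum_val B f :
  \sum_(y <- B) f y = \sum_(i < #|{: B}|) f (val (enum_val i)).
Proof.
rewrite big_seq_fsetE /= (reindex (@enum_val _ {: B})) //=.
exact/onW_bij/enum_val_bij.
Qed.

Lemma centryD B (u w : 'cV[R]_#|{: B}|) x :
  centry (u + w) x = centry u x + centry w x.
Proof. by rewrite /centry; case: insub => [b|]; rewrite ?mxE ?addr0. Qed.

Lemma centryZ B a (u : 'cV[R]_#|{: B}|) x : centry (a *: u) x = a * centry u x.
Proof. by rewrite /centry; case: insub => [b|]; rewrite ?mxE ?mulr0. Qed.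

Lemma centry_mulmx B C (N : 'M[R]_(#|{: B}|, #|{: C}|)) (u : 'cV[R]_#|{: C}|) x :
  centry (N *m u) x = \sum_(y <- C) entry N x y * centry u y.
Proof.
rewrite sum_fset_enum_val /centry /entry; case: insubP => [b _ _|_].
  rewrite mxE; apply: eq_bigr => i _.
  by rewrite !valK !enum_valK.
by rewrite big1 // => i _; rewrite valK mul0r.
Qed.

Lemma entry_block B C M x y : x \in B -> y \in C -> entry (block B C M) x y = M x y.
Proof.
move=> /fset_enum_val[i ->] /fset_enum_val[j ->].
by rewrite entry_val mxE.
Qed.

Lemma entry_mulmx B C D (N : 'M[R]_(#|{: B}|, #|{: C}|)) M x y : y \in D ->
  entry (N *m block C D M) x y = centry (N *m restr C (M^~ y)) x.
Proof.
move=> /fset_enum_val[j ->]; rewrite /entry /centry; case: insub => [b|] //.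
by rewrite valK enum_valK !mxE; apply: eq_bigr => k _; rewrite !mxE.
Qed.

(** The maximum principle for [M] on [B]: a function that dominates its image
    under the restriction of [M] to [B] is nonnegative on [B].  It makes
    [I - M] injective on functions on [B], and its inverse monotone. *)
Definition max_principle B M := forall f,
  (forall x, x \in B -> \sum_(y <- B) M x y * f y <= f x) ->
  forall x, x \in B -> 0 <= f x.

Lemma max_principle_unitmx B M :
  max_principle B M -> 1%:M - block B B M \in unitmx.
Proof.
move=> MP.
have inj (u : 'cV[R]_#|{: B}|) : (1%:M - block B B M) *m u = 0 -> forall i, 0 <= u i 0.
  move=> u0 i; rewrite -centry_val; apply: (MP (centry u)); last exact: fsvalP.
  move=> _ /fset_enum_val[j ->]; rewrite sum_fset_enum_val centry_val.
  move/matrixP: u0 => /(_ j 0); rewrite mulmxBl mul1mx !mxE => /subr0_eq ->.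
  by apply: ler_sum => k _; rewrite mxE centry_val.
rewrite -unitmx_tr -row_free_unit -kermx_eq0; apply/eqP/row_matrixP => i.
rewrite row0; set r := row i _.
have r0 : r *m (1%:M - block B B M)^T = 0.
  by rewrite -row_mul mulmx_ker row0.
have u0 : (1%:M - block B B M) *m r^T = 0.
  by rewrite -[LHS]trmxK trmx_mul trmxK r0 trmx0.
have u0' : (1%:M - block B B M) *m (- r^T) = 0 by rewrite mulmxN u0 oppr0.
apply/rowP => j; rewrite mxE; apply/eqP.
rewrite eq_le; have := inj _ u0 j; have := inj _ u0' j.
by rewrite !mxE oppr_ge0 => -> ->.
Qed.

Lemma invmx_block_fixpoint B M h x : max_principle B M -> x \in B ->
  let u := invmx (1%:M - block B B M) *m restr B h in
  centry u x = h x + \sum_(y <- B) M x y * centry u y.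
Proof.
move=> MP /fset_enum_val[i ->] u; apply/eqP; rewrite -subr_eq; apply/eqP.
have : (1%:M - block B B M) *m u = restr B h.
  by rewrite mulmxA mulmxV ?mul1mx ?max_principle_unitmx.
clearbody u; move=> /matrixP/(_ i 0); rewrite mulmxBl mul1mx !mxE centry_val => <-.
congr (_ - _); rewrite sum_fset_enum_val; apply: eq_bigr => j _.
by rewrite mxE centry_val.
Qed.

(** Comparison: a subsolution [f] of [u = h + M u] on [B] lies below every
    supersolution [g]. *)
Lemma max_principle_le B M f g h :
  max_principle B M ->
  (forall x, x \in B -> f x <= h x + \sum_(y <- B) M x y * f y) ->
  (forall x, x \in B -> h x + \sum_(y <- B) M x y * g y <= g x) ->
  forall x, x \in B -> f x <= g x.
Proof.
move=> MP hf hg x xB; rewrite -subr_ge0.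
apply: (MP (fun x => g x - f x)) => // y yB.
have := hf y yB; have := hg y yB.
under [X in X <= g y - f y]eq_bigr do rewrite mulrBr.
rewrite sumrB; set a := \sum_(_ <- _) _ ; set b := \sum_(_ <- _) _.
lra.
Qed.

Lemma max_norm_ge0 n (u : 'cV[R]_n) : 0 <= max_norm u.
Proof. by rewrite /max_norm; elim/big_ind: _ => // a b a0 b0; rewrite le_max a0. Qed.

Lemma centry_le_max_norm B (u : 'cV[R]_#|{: B}|) x : centry u x <= max_norm u.
Proof.
rewrite /centry; case: insub => [b|]; last exact: max_norm_ge0.
by apply: (le_trans (ler_norm _)); apply: le_bigmax.
Qed.

End Blocks.

(** * The chain watched on [K] until it leaves [A] *)

Section Censoring.
Context (R : realType) (S : countType) (P : S -> S -> R).
Context (K : {fset S}) (z : S) (A : {fset S}) (q v : S -> R).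
Hypothesis P_ge0 : forall x y, 0 <= P x y.
Hypothesis KA : (K `<=` A)%fset.
Hypothesis zK : z \in K.
Hypothesis MP_A' : max_principle (A `\` K)%fset P.
Hypothesis MP_Az : max_principle (A `\ z)%fset P.

Local Notation A' := (A `\` K)%fset.
Local Notation Kt := (K `\ z)%fset.
Implicit Types (f g h e : S -> R).

(** The probability of leaving [A] in one step from [x]. *)
Definition exit_prob (x : S) : R := 1 - \sum_(y <- A) P x y.

(** The probability, from [x] in [A], that the first visit to [K] at a positive
    time happens at [y] and before the chain leaves [A].  It is the kernel [G]
    when [x] is in [K] and [(I - P22)^-1 P21] when [x] is in [A - K]; with this
    convention all one-step equations below take one form on the whole of
    [A]. *)
Definition censored (x y : S) : R :=
  if x \in K then Gker P K A x y else entry (N22 P K A *m block A' K P) x y.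

Let n2 g x := centry (N22 P K A *m restr A' g) x.

Let n2E g x : x \in A' -> n2 g x = g x + \sum_(a <- A') P x a * n2 g a.
Proof. exact: invmx_block_fixpoint. Qed.

Lemma in_A' x : x \in A -> x \notin K -> x \in A'.
Proof. by rewrite inE => -> ->. Qed.

Lemma notin_K x : x \in A' -> x \notin K.
Proof. by rewrite inE => /andP[]. Qed.

Lemma sum_A_split f : \sum_(y <- A) f y = \sum_(y <- K) f y + \sum_(y <- A') f y.
Proof.
rewrite -big_cat; apply: perm_big; apply: uniq_perm => //.
  rewrite cat_uniq !fset_uniq /= andbT; apply/hasPn => y /=.
  by rewrite inE => /andP[].
move=> y; rewrite mem_cat /= in_fsetD.
by have [yK|] := boolP (y \in K); rewrite //= (fsubsetP KA).
Qed.

Lemma sum_Az_split f :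
  \sum_(y <- (A `\ z)%fset) f y = \sum_(y <- Kt) f y + \sum_(y <- A') f y.
Proof.
rewrite -big_cat; apply: perm_big; apply: uniq_perm => //.
  rewrite cat_uniq !fset_uniq /= andbT; apply/hasPn => y /=.
  by rewrite !inE => /andP[/negPf->]; rewrite andbF.
move=> y; rewrite mem_cat /= !inE.
have [->|yz] := eqVneq y z; first by rewrite zK.
by have [yK|] := boolP (y \in K); rewrite //= (fsubsetP KA).
Qed.

Lemma in_Az x : x \in (A `\ z)%fset -> x \in Kt \/ x \in A'.
Proof.
rewrite !inE => /andP[-> ->]; case: (x \in K); by [left|right].
Qed.

Lemma Kt_A x : x \in Kt -> x \in A.
Proof. by rewrite inE => /andP[_ /(fsubsetP KA)]. Qed.

Lemma A'_A x : x \in A' -> x \in A.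
Proof. by rewrite inE => /andP[]. Qed.

Lemma Kt_K x : x \in Kt -> x \in K.
Proof. by rewrite inE => /andP[]. Qed.

Let rowP12 u x : x \in K ->
  centry (block K A' P *m u) x = \sum_(a <- A') P x a * centry u a.
Proof.
move=> xK; rewrite centry_mulmx big_seq [RHS]big_seq; apply: eq_bigr => a aA.
by rewrite entry_block.
Qed.

(** The first-step equation for the cost accumulated before the next visit to
    [K] or the exit from [A]; [ktilde_fun], [censored], [xi_fun] and [betaq] satisfy similar
    ones. *)
Lemma k_funE x : x \in A ->
  k_fun P K A q x = q x + \sum_(a <- A') P x a * k_fun P K A q a.
Proof.
move=> xA.
have -> : \sum_(a <- A') P x a * k_fun P K A q a = \sum_(a <- A') P x a * n2 q a.
  rewrite big_seq [RHS]big_seq; apply: eq_bigr => a /notin_K aK.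
  by rewrite /k_fun (negPf aK).
rewrite /k_fun; case: ifPn => xK; last by rewrite -n2E ?in_A'.
by rewrite -mulmxA rowP12.
Qed.

Lemma ktilde_funE x : x \in A ->
  ktilde_fun P K A v x = Pv3 P A v x + \sum_(a <- A') P x a * ktilde_fun P K A v a.
Proof.
move=> xA.
have -> : \sum_(a <- A') P x a * ktilde_fun P K A v a =
    \sum_(a <- A') P x a * n2 (Pv3 P A v) a.
  rewrite big_seq [RHS]big_seq; apply: eq_bigr => a /notin_K aK.
  by rewrite /ktilde_fun (negPf aK).
rewrite /ktilde_fun; case: ifPn => xK; last by rewrite -n2E ?in_A'.
by rewrite -mulmxA rowP12.
Qed.

Lemma censoredE x y : x \in A -> y \in K ->
  censored x y = P x y + \sum_(a <- A') P x a * censored a y.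
Proof.
move=> xA yK.
have -> : \sum_(a <- A') P x a * censored a y =
    \sum_(a <- A') P x a * n2 (P^~ y) a.
  rewrite big_seq [RHS]big_seq; apply: eq_bigr => a /notin_K aK.
  by rewrite /censored (negPf aK) entry_mulmx.
rewrite /censored; case: ifPn => xK; last by rewrite entry_mulmx // -n2E ?in_A'.
by rewrite /Gker entry_mulmx // -mulmxA rowP12.
Qed.

Lemma xi_fun_censored x : xi_fun P K A x = 1 - \sum_(y <- K) censored x y.
Proof.
by rewrite /xi_fun; case: ifPn => xK; congr (_ - _); apply: eq_bigr => y _;
  rewrite /censored ?xK ?(negPf xK).
Qed.

Lemma xi_funE x : x \in A ->
  xi_fun P K A x = exit_prob x + \sum_(a <- A') P x a * xi_fun P K A a.
Proof.
move=> xA; rewrite xi_fun_censored /exit_prob sum_A_split.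
have -> : \sum_(y <- K) censored x y =
    \sum_(y <- K) P x y + \sum_(a <- A') P x a * \sum_(y <- K) censored a y.
  under [X in _ + X]eq_bigr do rewrite mulr_sumr.
  rewrite exchange_big -big_split big_seq [RHS]big_seq /=.
  by apply: eq_bigr => y yK; rewrite censoredE.
under [X in _ = _ + X]eq_bigr do rewrite xi_fun_censored mulrBr mulr1.
rewrite sumrB; ring.
Qed.

Lemma betaqE x : x \in A ->
  betaq P K A q v x = q x + Pv3 P A v x + \sum_(a <- A') P x a * betaq P K A q v a.
Proof.
move=> xA; rewrite /betaq k_funE // ktilde_funE //.
under [X in _ = _ + X]eq_bigr do rewrite mulrDr.
rewrite big_split /=; ring.
Qed.

Lemma censored_ge0 x y : x \in A' -> y \in K -> 0 <= censored x y.
Proof.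
move=> xA yK; apply: (MP_A' (f := censored^~ y)) => // t tA.
by rewrite [leRHS]censoredE ?A'_A // lerDr.
Qed.

Lemma xi_fun_ge0 x : (forall y, y \in A -> 0 <= exit_prob y) ->
  x \in A -> 0 <= xi_fun P K A x.
Proof.
move=> p0.
have xi0 y : y \in A' -> 0 <= xi_fun P K A y.
  apply: MP_A' => // t /A'_A tA.
  by rewrite [leRHS]xi_funE // lerDr p0.
move=> xA; rewrite xi_funE // addr_ge0 ?p0 // big_seq sumr_ge0 // => a aA.
by rewrite mulr_ge0 ?xi0.
Qed.

(** If [e] solves the first-step equation with source [h] on [A], then adding
    the contribution of boundary values [f] on [K - {z}] through the censored
    kernel solves the equation for the chain killed at [z] and outside [A]. *)
Lemma extensionE e h f x :
  (forall y, y \in A -> e y = h y + \sum_(a <- A') P y a * e a) ->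
  x \in A ->
  e x + \sum_(y <- Kt) censored x y * f y =
  h x + \sum_(y <- Kt) P x y * f y
  + \sum_(a <- A') P x a * (e a + \sum_(y <- Kt) censored a y * f y).
Proof.
move=> eE xA; rewrite {1}eE //.
have -> : \sum_(y <- Kt) censored x y * f y = \sum_(y <- Kt) P x y * f y
   + \sum_(a <- A') P x a * \sum_(y <- Kt) censored a y * f y.
  under [X in _ + X]eq_bigr do rewrite mulr_sumr.
  rewrite exchange_big -big_split big_seq [RHS]big_seq /=.
  apply: eq_bigr => y /Kt_K yK; rewrite censoredE // mulrDl mulr_suml.
  by congr (_ + _); apply: eq_bigr => a _; rewrite mulrA.
under [X in _ = _ + X]eq_bigr do rewrite mulrDr.
rewrite big_split /=; ring.
Qed.

(** The maximum principle passes from [P] on [A - {z}] to [G] on [K - {z}]: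
    a function on [K - {z}] is extended to [A - K] by the censored kernel. *)
Lemma max_principle_Gker : max_principle Kt (Gker P K A).
Proof.
move=> f fG x xK.
pose F y := if y \in K then f y else \sum_(y' <- Kt) censored y y' * f y'.
suff : 0 <= F x by rewrite /F Kt_K.
apply: MP_Az; last by move: xK; rewrite !inE => /andP[-> /(fsubsetP KA)].
(* The zero function solves the first-step equation with zero source. *)
have zero (y : S) : y \in A -> 0 = 0 + \sum_(a <- A') P y a * (0 : R).
  by move=> _; rewrite big1 ?addr0 // => a _; rewrite mulr0.
move=> t tA; rewrite sum_Az_split.
have tA' : t \in A by move: tA; rewrite inE => /andP[].
have -> : \sum_(y <- Kt) P t y * F y = \sum_(y <- Kt) P t y * f y.
  rewrite big_seq [RHS]big_seq; apply: eq_bigr => y /Kt_K yK.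
  by rewrite /F yK.
have -> : \sum_(a <- A') P t a * F a =
    \sum_(a <- A') P t a * (0 + \sum_(y <- Kt) censored a y * f y).
  rewrite big_seq [RHS]big_seq; apply: eq_bigr => y /notin_K yK.
  by rewrite /F (negPf yK) add0r.
have := extensionE (e := fun=> 0) f zero tA'; rewrite !add0r => <-.
rewrite /F; case: ifPn => // tK; apply: le_trans (fG t _); last first.
  by case/in_Az: tA => // /notin_K; rewrite tK.
by apply: ler_sum => y _; rewrite /censored tK.
Qed.

(** Elimination of [A - K]: an inequality along one step of the chain killed at
    [z] and outside [A] gives one along the censored kernel. *)
Lemma censored_subsol e h f :
  (forall x, x \in A -> e x = h x + \sum_(a <- A') P x a * e a) ->
  (forall x, x \in (A `\ z)%fset ->
     f x <= h x + \sum_(y <- Kt) P x y * f y + \sum_(a <- A') P x a * f a) ->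
  forall x, x \in (A `\ z)%fset -> f x <= e x + \sum_(y <- Kt) censored x y * f y.
Proof.
move=> eE fle.
have le' x : x \in A' -> f x <= e x + \sum_(y <- Kt) censored x y * f y.
  apply: (max_principle_le (g := fun x => e x + \sum_(y <- Kt) censored x y * f y)
     (h := fun x => h x + \sum_(y <- Kt) P x y * f y) MP_A') => y yA.
    by apply: fle; move: yA; rewrite !inE => /andP[+ ->]; case: eqP => // ->; rewrite zK.
  by rewrite [leRHS](extensionE f eE) // A'_A.
move=> x xA; have xA' : x \in A by move: xA; rewrite inE => /andP[].
rewrite (extensionE f eE) // (le_trans (fle _ _)) // lerD2l big_seq [leRHS]big_seq.
by apply: ler_sum => a aA; rewrite ler_wpM2l // le'.
Qed.

(** The lower bound is below every supersolution of the cost equation for the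
    chain killed at [z] and outside [A]. *)
Lemma kappa_lower_le f :
  (forall x, x \in (A `\ z)%fset ->
     q x + \sum_(y <- Kt) P x y * f y + \sum_(a <- A') P x a * f a <= f x) ->
  forall x, x \in (A `\ z)%fset -> kappa_lower P K z A q x <= f x.
Proof.
move=> fge.
(* [censored_subsol] is applied to the opposite of [f]. *)
have step x : x \in (A `\ z)%fset ->
    k_fun P K A q x + \sum_(y <- Kt) censored x y * f y <= f x.
  move=> xA; rewrite -lerN2.
  apply: (le_trans (@censored_subsol (fun x => - k_fun P K A q x) (fun x => - q x)
     (fun x => - f x) _ _ x xA)).
  - move=> y yA; rewrite k_funE // opprD; congr (_ + _).
    by rewrite -sumrN; apply: eq_bigr => a _; rewrite mulrN.
  - move=> y yA; rewrite -lerN2 opprK !opprD !opprK (le_trans _ (fge y yA)) //.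
    by rewrite -!sumrN lerD ?lerD // ler_sum // => a _; rewrite mulrN opprK.
  - rewrite opprD lerD2l -sumrN.
    by apply: ler_sum => y _; rewrite mulrN.
have KtAz x : x \in Kt -> x \in (A `\ z)%fset.
  by rewrite !inE => /andP[-> /(fsubsetP KA)].
have onKt x : x \in Kt -> centry (kappa_lower_vec P K z A q) x <= f x.
  apply: (max_principle_le (h := k_fun P K A q) max_principle_Gker) => y yK.
    by rewrite {1}/kappa_lower_vec invmx_block_fixpoint //; exact: max_principle_Gker.
  apply: le_trans (step _ (KtAz _ yK)); rewrite lerD2l.
  by apply: ler_sum => t _; rewrite /censored Kt_K.
move=> x xA; rewrite /kappa_lower; case: ifPn => xK; first exact: onKt.
have xA' : x \in A' by case/in_Az: xA => // xKt; rewrite xKt in xK.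
apply: le_trans (step _ xA); rewrite lerD2l big_seq [leRHS]big_seq.
apply: ler_sum => y yKt; have := censored_ge0 xA' (Kt_K yKt).
rewrite /censored (negPf (notin_K xA')) => c0.
by rewrite ler_wpM2l // onKt.
Qed.

(** The upper bound, for a subsolution [f] of the equation in which the cost
    incurred after leaving [A] is charged as [v] at the exit point plus [m].
    The hypotheses on [m] say that [m] is the least nonnegative upper bound
    of [f] on [K - {z}], hence zero if [K - {z}] is empty; on [K - {z}] this
    gives [f <= (I - G)^-1 beta + m (I - G)^-1 xi], and then a bound on [m]
    because the norm of [(I - G)^-1 xi] is less than one. *)
Lemma le_kappa_upper f m :
  (forall y, y \in A -> 0 <= exit_prob y) ->
  norm_Ginv_xi P K z A < 1 ->
  0 <= m ->
  (forall x, x \in Kt -> f x <= m) ->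
  (forall m', 0 <= m' -> (forall x, x \in Kt -> f x <= m') -> m <= m') ->
  (forall x, x \in (A `\ z)%fset ->
     f x <= q x + Pv3 P A v x + m * exit_prob x
            + \sum_(y <- Kt) P x y * f y + \sum_(a <- A') P x a * f a) ->
  forall x, x \in (A `\ z)%fset -> f x <= kappa_upper P K z A q v x.
Proof.
move=> p0 xi1 m0 fm mmin fle.
set h := fun x => q x + Pv3 P A v x + m * exit_prob x.
set e := fun x => betaq P K A q v x + m * xi_fun P K A x.
have eE x : x \in A -> e x = h x + \sum_(a <- A') P x a * e a.
  move=> xA; rewrite /e /h betaqE // xi_funE //.
  under [X in _ = _ + X]eq_bigr do rewrite mulrDr mulrCA.
  rewrite big_split /= -mulr_sumr; ring.
have step := censored_subsol eE fle.
have KtAz x : x \in Kt -> x \in (A `\ z)%fset.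
  by rewrite !inE => /andP[-> /(fsubsetP KA)].
pose gb := centry (Ginv P K z A *m restr Kt (betaq P K A q v)).
pose gx := centry (Ginv P K z A *m restr Kt (xi_fun P K A)).
have gbE x : x \in Kt -> gb x = _ := invmx_block_fixpoint _ max_principle_Gker.
have gxE x : x \in Kt -> gx x = _ := invmx_block_fixpoint _ max_principle_Gker.
have gx0 x : x \in Kt -> 0 <= gx x.
  apply: max_principle_Gker => y yK; rewrite [leRHS]gxE // lerDr.
  by rewrite xi_fun_ge0 // Kt_A.
have onKt x : x \in Kt -> f x <= gb x + m * gx x.
  apply: (max_principle_le (g := fun x => gb x + m * gx x) (h := e)
    max_principle_Gker) => y yK.
    apply: (le_trans (step _ (KtAz _ yK))); rewrite lerD2l.
    by apply: ler_sum => t _; rewrite /censored Kt_K.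
  rewrite [leRHS](_ : _ = e y + \sum_(y0 <- Kt) Gker P K A y y0 * (gb y0 + m * gx y0)) //.
  rewrite [in LHS]gbE // [in LHS]gxE // /e.
  under [X in _ = _ + X]eq_bigr do rewrite mulrDr [_ * (m * _)]mulrCA.
  by rewrite big_split /= -mulr_sumr; rewrite -/gb -/gx; ring.
set b := max_norm (Ginv P K z A *m restr Kt (betaq P K A q v)).
set r := norm_Ginv_xi P K z A in xi1.
have b0 : 0 <= b by exact: max_norm_ge0.
have r0 : 0 <= r by exact: max_norm_ge0.
have mb : m <= b / (1 - r).
  rewrite ler_pdivlMr ?subr_gt0 // mulrBr mulr1 lerBlDr.
  apply: mmin; first by rewrite addr_ge0 // mulr_ge0.
  move=> x xK; apply: (le_trans (onKt _ xK)); rewrite lerD ?ler_wpM2l //;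
    exact: centry_le_max_norm.
have onKt' x : x \in Kt -> f x <= centry (kappa_upper_vec P K z A q v) x.
  move=> xK; rewrite /kappa_upper_vec centryD centryZ.
  by rewrite (le_trans (onKt _ xK)) // lerD2l ler_wpM2r // gx0.
move=> x xA; rewrite /kappa_upper; case: ifPn => xK; first exact: onKt'.
have xA' : x \in A' by case/in_Az: xA => // xKt; rewrite xKt in xK.
apply: (le_trans (step _ xA)); rewrite /e addrAC lerD // ?lerD2l.
  rewrite big_seq [leRHS]big_seq.
  apply: ler_sum => y yKt; have := censored_ge0 xA' (Kt_K yKt).
  rewrite /censored (negPf (notin_K xA')) => c0.
  by rewrite ler_wpM2l // onKt'.
rewrite mulrC ler_wpM2l ?xi_fun_ge0 ?A'_A //.
apply: mmin; first exact: max_norm_ge0.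
by move=> y yK; apply: (le_trans (onKt' _ yK)); exact: centry_le_max_norm.
Qed.

End Censoring.

(** * Sums over countable types and discrete random variables *)

Section CountableSums.
Local Open Scope ereal_scope.
Context (R : realType) (T : countType).
Implicit Types (a : T -> \bar R).

Lemma esum_pickle a : (forall t, 0 <= a t) ->
  \esum_(t in [set: T]) a t =
  \sum_(0 <= k <oo) oapp a 0 (pickle_inv k).
Proof.
move=> a0; rewrite nneseries_esumT; last by move=> k; case: pickle_inv.
rewrite (esumID (range (@choice.pickle T))); last by move=> k _; case: pickle_inv.
rewrite setTI [X in _ + X]esum1 ?adde0; last first.
  move=> k [_ nk]; have := @pickle_invK T k; case: pickle_inv => //= t tk.
  by exfalso; apply: nk; exists t.
rewrite esum_image; last by move=> s t _ _ /(pcan_inj (@choice.pickleK T)).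
by apply: eq_esum => t _; rewrite pickleK_inv.
Qed.

Lemma esumZl (r : R) a : (forall t, 0 <= a t) -> (0 <= r)%R ->
  \esum_(t in [set: T]) (r%:E * a t) = r%:E * \esum_(t in [set: T]) a t.
Proof.
move=> a0 r0; rewrite !esum_pickle //; last by move=> t; rewrite mule_ge0 ?lee_fin.
rewrite -nneseriesZl; last by move=> k _; case: pickle_inv.
by apply: eq_eseriesr => k _; case: pickle_inv => //=; rewrite mule0.
Qed.

End CountableSums.

Section DiscreteVariables.
Local Open Scope ereal_scope.
Context d (Omega : measurableType d) (R : realType).
Context (T : countType) (Y : Omega -> T).
Hypothesis mY : forall t, measurable (Y @^-1` [set t]).

Lemma measurable_discrete (D : set T) : measurable (Y @^-1` D).
Proof.
rewrite [X in measurable X](_ : _ = \bigcup_t (Y @^-1` [set t] `&` [set w | D t])).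
  apply: countable_bigcupT_measurable => // t.
  have [Dt|Dt] := pselect (D t).
    rewrite [X in measurable X](_ : _ = Y @^-1` [set t]) //.
    by apply/seteqP; split => w //= [].
  rewrite [X in measurable X](_ : _ = set0) //.
  by apply/seteqP; split => w //= [].
apply/seteqP; split => w /=; first by move=> Dw; exists (Y w).
by move=> [t _ [/= -> ]].
Qed.

Lemma measurable_fun_discrete (E : set Omega) (phi : T -> \bar R) :
  measurable E -> measurable_fun E (fun w : Omega => phi (Y w)).
Proof.
move=> mE _ B mB; apply: measurableI => //.
exact: measurable_discrete (phi @^-1` B).
Qed.

Lemma integral_discrete (mu : {measure set Omega -> \bar R}) (E : set Omega)
    (phi : T -> \bar R) :
  measurable E -> (forall t, 0 <= phi t) ->
  \int[mu]_(w in E) phi (Y w) =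
  \esum_(t in [set: T]) (phi t * mu (E `&` Y @^-1` [set t])).
Proof.
move=> mE phi0.
(* [E] is cut along the values of [Y], numbered by [pickle]. *)
pose F k := E `&` Y @^-1` [set t | choice.pickle t = k].
have mF k : measurable (F k).
  by apply: measurableI => //; exact: measurable_discrete.
have EF : E = \bigcup_k F k.
  apply/seteqP; split => w /=; first by move=> Ew; exists (choice.pickle (Y w)).
  by move=> [k _ []].
rewrite [in LHS]EF ge0_integral_bigcup //; last 2 first.
- by rewrite -EF; exact: measurable_fun_discrete.
- by move=> i j _ _ [w [[_ /= <-] [_ /= <-]]].
rewrite esum_pickle; last by move=> t; rewrite mule_ge0.
apply: eq_eseriesr => k _.
have := @pickle_invK T k; case pk: (pickle_inv k) => [t|] /= tk.
  rewrite -integral_cst; last exact: measurableI.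
  rewrite (_ : F k = E `&` Y @^-1` [set t]).
    by apply: eq_integral => w; rewrite inE => -[_ /= ->].
  apply/seteqP; split => w [Ew /=] Yw; split => //=; last by rewrite Yw.
  by apply: (pcan_inj (@choice.pickleK T)); rewrite Yw tk.
have [{}tk|nk] := pselect (exists t : T, choice.pickle t = k); last first.
  rewrite (_ : F k = set0) ?integral_set0 //.
  by apply/seteqP; split => w //= [_ /= Yw]; apply: nk; exists (Y w).
by case: tk pk => t <-; rewrite pickleK_inv.
Qed.

End DiscreteVariables.

(** * The expected cost as a Neumann series *)

Section ChainLaw.
Local Open Scope ereal_scope.
Context (R : realType) (S : countType) (P : S -> S -> R).
Context (d : measure_display) (Omega : measurableType d).
Context (Pr : S -> probability Omega R) (X : nat -> Omega -> S).
Hypothesis hX : markov_chain P Pr X.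
Implicit Types (phi : S -> \bar R) (x y z : S).

(** [(P phi)(x)] with the sum restricted to [B]; in contrast to [kernel_sum],
    [phi] takes extended values. *)
Definition kernel_op (B : set S) phi x : \bar R := \esum_(y in B) ((P x y)%:E * phi y).

(** The path [X 0, ..., X n]. *)
Definition history n (w : Omega) : seq S := mkseq (X^~ w) n.+1.

Let P_ge0 x y : (0 <= P x y)%R. Proof. by case: (mc_stochastic hX) => + _; apply. Qed.

Lemma kernel_op_ge0 B phi x : (forall y, 0 <= phi y) -> 0 <= kernel_op B phi x.
Proof. by move=> p0; apply: esum_ge0 => y _; rewrite mule_ge0 ?lee_fin. Qed.

Lemma historyP x n w (s : seq S) : size s = n.+1 ->
  history n w = s <-> (forall i, (i <= n)%N -> X i w = nth x s i).
Proof.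
move=> sn; split=> [<- i ilen|sE]; first by rewrite nth_mkseq.
apply: (@eq_from_nth _ x); rewrite size_mkseq // => i ilt.
by rewrite nth_mkseq // sE.
Qed.

Lemma measurable_history n s : measurable (history n @^-1` [set s]).
Proof.
have [sn|sn] := eqVneq (size s) n.+1; last first.
  rewrite [X in measurable X](_ : _ = set0) //; apply/seteqP; split => w //= sE.
  by rewrite -sE size_mkseq eqxx in sn.
case: s sn => // x s sn.
rewrite [X in measurable X](_ : _ =
    \bigcap_(i in `I_n.+1) (X i @^-1` [set nth x (x :: s) i])).
  by apply: bigcap_measurable => [|k _]; [exists 0%N|exact: (mc_measurable hX)].
by apply/seteqP; split => w /=; move/(historyP x w sn).
Qed.

(** The Markov property, for sequences [s] of any length: both sides vanish
    unless [s] has [n.+1] entries. *)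
Lemma prob_history_next x n s y :
  Pr x (history n @^-1` [set s] `&` X n.+1 @^-1` [set y]) =
  Pr x (history n @^-1` [set s]) * (P (last x s) y)%:E.
Proof.
have [sn|sn] := eqVneq (size s) n.+1; last first.
  rewrite (_ : history n @^-1` [set s] = set0) ?set0I ?measure0 ?mul0e //.
  apply/seteqP; split => w //= sE.
  by rewrite -sE size_mkseq eqxx in sn.
have := mc_markov hX x n (nth x s) y.
rewrite -nth_last sn /= => mk.
rewrite (_ : history n @^-1` [set s] =
    [set w | forall i, (i <= n)%N -> X i w = nth x s i]).
  by rewrite -mk; congr (Pr x _).
by apply/seteqP; split => w /=; move/(historyP x w sn).
Qed.

(** The Markov property in integrated form: given an event of the first [n]
    steps, the expectation of [phi] at time [n.+1] is that of [P phi] at time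
    [n]. *)
Lemma integral_markov x n (D : set (seq S)) phi : (forall y, 0 <= phi y) ->
  \int[Pr x]_(w in history n @^-1` D) phi (X n.+1 w) =
  \int[Pr x]_(w in history n @^-1` D) kernel_op setT phi (X n w).
Proof.
move=> p0.
have mE : measurable (history n @^-1` D).
  by apply: measurable_discrete; exact: measurable_history.
(* Both sides are expanded along the values of the path and of [X n.+1]. *)
pose Y w := (history n w, X n.+1 w).
have mY t : measurable (Y @^-1` [set t]).
  rewrite [X in measurable X](_ : _ =
    history n @^-1` [set t.1] `&` X n.+1 @^-1` [set t.2]).
    by apply: measurableI; [exact: measurable_history|exact: (mc_measurable hX)].
  case: t => a b; apply/seteqP; split => w [wa wb]; first by split.
  by rewrite /= /Y wa wb.
rewrite (integral_discrete mY (Pr x) (phi := phi \o snd)) //=.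
have XnE w : X n w = last x (history n w).
  by rewrite -nth_last size_mkseq nth_mkseq.
under [RHS]eq_integral do rewrite XnE.
rewrite (integral_discrete (@measurable_history n) (Pr x)
   (phi := fun s => kernel_op setT phi (last x s))) //=; last first.
  by move=> s; exact: kernel_op_ge0.
pose a s y := phi y * Pr x (history n @^-1` D `&` Y @^-1` [set (s, y)]).
transitivity (\esum_(k in [set: seq S] `*`` (fun=> [set: S])) a k.1 k.2).
  rewrite (_ : _ `*`` _ = setT); last exact/seteqP.
  by apply: eq_esum => -[].
rewrite -esum_esum; last by move=> s y _ _; rewrite mule_ge0.
apply: eq_esum => s _.
have [Ds|nDs] := pselect (D s); last first.
  rewrite (_ : _ `&` history n @^-1` [set s] = set0) ?measure0 ?mule0; last first.
    by apply/seteqP; split => w //= [Dw sE]; rewrite sE in Dw.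
  apply: esum1 => y _.
  rewrite /a (_ : _ `&` _ = set0) ?measure0 ?mule0 //.
  by apply/seteqP; split => w //= [Dw [sE _]]; rewrite sE in Dw.
rewrite (_ : _ `&` history n @^-1` [set s] = history n @^-1` [set s]); last first.
  by apply/seteqP; split => w //= [] // ->.
have mufin : Pr x (history n @^-1` [set s]) \is a fin_num.
  by rewrite fin_num_measure //; exact: measurable_history.
rewrite muleC -(fineK mufin) -esumZl ?fine_ge0 //; last first.
  by move=> y; rewrite mule_ge0 ?lee_fin.
apply: eq_esum => y _.
rewrite /a (_ : _ `&` _ = history n @^-1` [set s] `&` X n.+1 @^-1` [set y]).
  by rewrite prob_history_next fineK // muleCA [phi y * _]muleC.
apply/seteqP; split => w; first by move=> [_ [ws wy]]; split.
by move=> [ws wy]; split; rewrite /= ?/Y ws // wy.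
Qed.

Lemma integral_init x phi : (forall y, 0 <= phi y) ->
  \int[Pr x]_w phi (X 0%N w) = phi x.
Proof.
move=> p0; rewrite (integral_discrete (Y := X 0%N)) //=; last first.
  by move=> t; exact: (mc_measurable hX).
have mX B : measurable (X 0%N @^-1` B) by exact: (mc_measurable hX).
have X0 : Pr x (~` (X 0%N @^-1` [set x])) = 0.
  by rewrite probability_setC // [Pr x _](mc_init hX) subee.
rewrite (esumID [set x]); last by move=> t _; rewrite mule_ge0.
rewrite !setTI esum_set1; last by rewrite mule_ge0.
rewrite setTI [Pr x _](mc_init hX) mule1 esum1 ?adde0 // => t /= tx.
rewrite setTI; apply/eqP; rewrite mule_eq0; apply/orP; right.
rewrite eq_le measure_ge0 andbT -X0 le_measure ?inE //; first exact: measurableC.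
by move=> w /= -> /eqP; move/eqP: tx => /negPf->.
Qed.

Lemma kernel_op_nz z phi x : (forall y, 0 <= phi y) ->
  kernel_op [set~ z] phi x = kernel_op setT (phi \_ [set~ z]) x.
Proof.
move=> p0; rewrite /kernel_op [LHS]esum_mkcond; apply: eq_esum => y _.
by rewrite patchE; case: ifP => //; rewrite mule0.
Qed.

(** The event that [z] is not visited at the times [1, ..., n]. *)
Definition survival z n : set Omega :=
  [set w | forall i, (1 <= i <= n)%N -> X i w <> z].

Lemma survivalE z n : survival z n =
  history n @^-1` [set s | forall i, (1 <= i <= n)%N -> nth z s i <> z].
Proof.
apply/seteqP; split => w /= sw i /andP[i1 il].
  by rewrite nth_mkseq //; apply: sw; rewrite i1.
by have := sw i; rewrite i1 il nth_mkseq // => /(_ isT).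
Qed.

(** The expectation of [phi (X n)] on the event that the return time to [z]
    exceeds [n]. *)
Lemma integral_survival z x n phi : (forall y, 0 <= phi y) ->
  \int[Pr x]_(w in survival z n) phi (X n w) = iter n (kernel_op [set~ z]) phi x.
Proof.
elim: n phi => [|n IH] phi p0.
  rewrite (_ : survival z 0 = setT); first exact: integral_init.
  by apply/seteqP; split => w //= _ i; case: i.
rewrite iterSr -IH; last by move=> y; exact: kernel_op_ge0.
transitivity (\int[Pr x]_(w in survival z n) (phi \_ [set~ z]) (X n.+1 w)).
  rewrite (_ : survival z n.+1 = X n.+1 @^-1` [set~ z] `&` survival z n).
    rewrite integral_mkcondl; apply: eq_integral => w _.
    by rewrite !patchE; congr (if _ then _ else _); apply/idP/idP; rewrite !inE.
  apply/seteqP; split => w /=.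
    move=> sw; split => [|i /andP[i1 i2]]; apply: sw; first by rewrite /= leqnn.
    by rewrite i1 /= leqW.
  move=> [Xz sw] i /andP[i1]; rewrite leq_eqVlt => /orP[/eqP-> //|il].
  by apply: sw; rewrite i1.
rewrite survivalE integral_markov.
  by apply: eq_integral => w _; rewrite kernel_op_nz.
by move=> y; rewrite patchE; case: ifP.
Qed.

Lemma lt_return_time z n w : (n%:R%:E < return_time R X z w) = (w \in survival z n).
Proof.
apply/idP/idP.
  move=> lt; rewrite inE => i /andP[i1 iln] Xi.
  have : return_time R X z w <= i%:R%:E by apply: ereal_inf_lbound; exists i.
  move=> /(lt_le_trans lt); rewrite lte_fin ltr_nat => /leq_trans /(_ iln).
  by rewrite ltnn.
rewrite inE => sw; apply: (@lt_le_trans _ _ n.+1%:R%:E).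
  by rewrite lte_fin ltr_nat.
apply/ereal_infP => _ [i [i1 Xi] <-]; rewrite lee_fin ler_nat leqNgt.
by apply/negP => iln; apply: (sw i) => //; rewrite i1.
Qed.

(** The expected cost accumulated before the return to [z] is the Neumann
    series of the kernel whose column [z] is removed. *)
Lemma expected_cost_series z (q : S -> R) x : (forall y, 0 <= q y)%R ->
  expected_cost Pr X z q x =
  \sum_(0 <= n <oo) iter n (kernel_op [set~ z]) (EFin \o q) x.
Proof.
move=> q0; rewrite /expected_cost.
under eq_integral => w _.
  rewrite eseries_mkcond.
  under eq_eseriesr do rewrite lt_return_time.
  over.
rewrite integral_nneseries //=.
- apply: eq_eseriesr => n _; rewrite -integral_survival //.
  rewrite [RHS]integral_mkcond; apply: eq_integral => w _.
  by rewrite patchE.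
- move=> n.
  rewrite [X in measurable_fun _ X](_ : _ =
     (fun s : seq S => if s \in [set s | forall i, (1 <= i <= n)%N -> nth z s i <> z]
        then (q (nth z s n))%:E else 0) \o history n).
    by apply: measurable_fun_discrete => //; exact: measurable_history.
  apply/funext => w /=; rewrite nth_mkseq //; congr (if _ then _ else _).
  by rewrite survivalE; apply/idP/idP; rewrite !inE.
- by move=> n w _; case: ifP; rewrite ?lee_fin.
Qed.

(** From a closed set [C] the chain never reaches a state outside [C]. *)
Lemma prob_closed (C : set S) x n z : (forall x y, C x -> ~ C y -> P x y = 0%R) ->
  C x -> ~ C z -> Pr x [set w | X n w = z] = 0.
Proof.
move=> closed Cx nCz.
(* The expectation of every function vanishing on [C] is zero, by induction
   on [n]: the kernel preserves the functions vanishing on [C]. *)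
have main phi : (forall y, 0 <= phi y) -> (forall y, C y -> phi y = 0) ->
    \int[Pr x]_w phi (X n w) = 0.
  elim: n phi => [|n IH] phi p0 pC; first by rewrite integral_init ?pC.
  have := @integral_markov x n setT phi p0; rewrite preimage_setT => ->.
  apply: IH => y; first exact: kernel_op_ge0.
  move=> Cy; apply: esum1 => y' _.
  have [Cy'|nCy'] := pselect (C y'); first by rewrite pC // mule0.
  by rewrite closed // mul0e.
have := main ((fun=> 1) \_ [set z]) _ _.
rewrite (_ : \int[_]_w _ = \int[Pr x]_(w in [set w | X n w = z]) cst 1 w).
  rewrite integral_cst ?mul1e; last exact: (mc_measurable hX n [set z]).
  apply => y; rewrite patchE; case: ifPn => //; rewrite inE => -> //.
rewrite [RHS]integral_mkcond; apply: eq_integral => w _; rewrite !patchE.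
by congr (if _ then _ else _); apply/idP/idP; rewrite !inE.
Qed.

End ChainLaw.

(** * Truncated costs and the drift condition *)

Section TruncationBounds.
Context (R : realType) (S : countType) (P : S -> S -> R).
Hypothesis sP : stochastic P.
Implicit Types (B K A : {fset S}) (f v q : S -> R) (x y z : S).

Let P_ge0 x y : 0 <= P x y. Proof. by case: sP. Qed.

Lemma esum_fset_seq B (a : S -> \bar R) : (forall y, (0 <= a y)%E) ->
  (\esum_(y in [set` B]) a y = \sum_(y <- B) a y)%E.
Proof. by move=> a0; rewrite esum_fset // [RHS]fsbig_seq. Qed.

Lemma sum_fset_le1 B x : \sum_(y <- B) P x y <= 1.
Proof.
rewrite -lee_fin -sumEFin -(@esum_fset_seq B (fun y => (P x y)%:E)); last first.
  by move=> y; rewrite lee_fin.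
case: sP => _ /(_ x) <-; rewrite [leLHS]esum_mkcond; apply: le_esum => y _.
by case: ifP => _; rewrite lee_fin.
Qed.

Lemma exit_prob_ge0 A x : 0 <= exit_prob P A x.
Proof. by rewrite subr_ge0 sum_fset_le1. Qed.

Lemma esum_exit_prob A x :
  (\esum_(y in [set y | y \notin A]) (P x y)%:E = (exit_prob P A x)%:E)%E.
Proof.
case: sP => _ /(_ x); rewrite (esumID [set` A]) => [|y _]; last by rewrite lee_fin.
rewrite !setTI esum_fset_seq => [|y]; last by rewrite lee_fin.
rewrite sumEFin (_ : ~` _ = [set y | y \notin A]); last first.
  by apply/seteqP; split => y /= /negP.
rewrite /exit_prob; set e := esum _ _; case: e => [r||] //.
by rewrite -EFinD => -[<-]; congr EFin; ring.
Qed.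

Lemma kernel_op_split z A (phi : S -> \bar R) x : (forall y, (0 <= phi y)%E) ->
  z \in A ->
  (kernel_op P [set~ z] phi x =
   \sum_(y <- (A `\ z)%fset) (P x y)%:E * phi y +
   kernel_op P [set y | y \notin A] phi x)%E.
Proof.
move=> p0 zA; rewrite /kernel_op.
have pp y : (0 <= (P x y)%:E * phi y)%E by rewrite mule_ge0 ?lee_fin.
rewrite (esumID [set` A]) //; congr (_ + _)%E.
  rewrite -esum_fset_seq //; congr esum.
  apply/seteqP; split => y /=; rewrite !inE; first by move=> [/eqP -> ->].
  by move=> /andP[/eqP].
congr esum; apply/seteqP; split => y /=; first by move=> [_ /negP].
move=> yA; split; last exact/negP.
by move=> yz; rewrite yz zA in yA.
Qed.

Lemma kernel_op_le_affine (B : set S) (phi : S -> \bar R) v a x :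
  0 <= a -> (forall y, 0 <= v y) ->
  (forall y, B y -> (phi y <= (v y + a)%:E)%E) ->
  (kernel_op P B phi x <=
    kernel_sum P B v x + a%:E * \esum_(y in B) (P x y)%:E)%E.
Proof.
move=> a0 v0 pv.
have -> : (a%:E * (\esum_(y in B) (P x y)%:E) = \esum_(y in B) (a * P x y)%:E)%E.
  rewrite [in LHS]esum_mkcond [RHS]esum_mkcond -esumZl //; last first.
    by move=> y; case: ifP => _; rewrite ?lee_fin.
  by apply: eq_esum => y _; case: ifP => _; rewrite ?mule0 ?EFinM.
rewrite /kernel_sum -esumD; last 2 first.
- by move=> y _; rewrite lee_fin mulr_ge0.
- by move=> y _; rewrite lee_fin mulr_ge0.
apply: le_esum => y By; apply: (@le_trans _ _ ((P x y)%:E * (v y + a)%:E)%E).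
  by rewrite lee_wpmul2l ?lee_fin ?pv.
by rewrite -EFinM -EFinD lee_fin mulrDr [a * _]mulrC.
Qed.

(** On a finite set avoiding [z], a function dominating its image and having a
    negative minimum would take this minimum on a closed set, which an
    irreducible chain leaves to reach [z]. *)
Lemma max_principle_irreducible (d : measure_display) (Omega : measurableType d)
    (Pr : S -> probability Omega R) (X : nat -> Omega -> S) z B :
  markov_chain P Pr X -> irreducible_chain Pr X -> z \notin B ->
  max_principle B P.
Proof.
move=> hX hirr zB f fsup x xB; rewrite leNgt; apply/negP => fx0.
pose y0 := [arg min_(y < [` xB]%fset) f (val y)]%O.
have [y0B ymin] : val y0 \in B /\ forall y, y \in B -> f (val y0) <= f y.
  split; first exact: fsvalP.
  by move=> y yB; rewrite /y0; case: arg_minP => // i _ /(_ [` yB]%fset isT).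
move: y0 y0B ymin => y0 y0B ymin; set m := f (val y0) in ymin.
have m0 : m < 0 by apply: le_lt_trans fx0; exact: ymin.
pose C := [set y | y \in B /\ f y = m].
have closed s t : C s -> ~ C t -> P s t = 0.
  move=> [sB fs] nCt.
  (* The sum of [P s * f] over [B] is at most [f s], the negative minimum [m] of
     [f]; this forces [P s] to charge only [C]. *)
  have key : \sum_(y <- B) P s y * (f y - m) <= m * (1 - \sum_(y <- B) P s y).
    under eq_bigr do rewrite mulrBr.
    by rewrite sumrB -mulr_suml mulrBr mulr1 [m * _]mulrC lerD2r -fs fsup.
  have pos y : y \in B -> 0 <= P s y * (f y - m).
    by move=> yB; rewrite mulr_ge0 // subr_ge0 ymin.
  have sum0 : 0 <= \sum_(y <- B) P s y * (f y - m).
    by rewrite big_seq sumr_ge0.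
  have mle : m * (1 - \sum_(y <- B) P s y) <= 0.
    by rewrite mulr_le0_ge0 ?(ltW m0) // subr_ge0 sum_fset_le1.
  have S1 : \sum_(y <- B) P s y = 1.
    apply/eqP; rewrite eq_sym -subr_eq0; have := le_trans sum0 key.
    by rewrite nmulr_rge0 // => le0; rewrite eq_le le0 subr_ge0 sum_fset_le1.
  have [tB|tB] := boolP (t \in B); last first.
    have := sum_fset_le1 (t |` B)%fset s; rewrite big_fsetU1 //= S1 gerDr => le0.
    by apply/eqP; rewrite eq_le le0 P_ge0.
  have /eqP : \sum_(y <- B) P s y * (f y - m) = 0.
    by apply/eqP; rewrite eq_le sum0 (le_trans key).
  rewrite big_seq psumr_eq0 // => /allP/(_ t tB); rewrite tB /= mulf_eq0.
  by case/orP => /eqP // /subr0_eq ft; exfalso; apply: nCt.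
have [n] := hirr (val y0) z.
rewrite (prob_closed hX n closed) ?ltxx //.
by move=> [zB' _]; rewrite zB' in zB.
Qed.

Section Drift.
Context (K : {fset S}) (z : S) (A : {fset S}) (q v : S -> R) (c : R).
Hypothesis zK : z \in K.
Hypothesis KA : (K `<=` A)%fset.
Hypothesis hq : forall x, 0 <= q x.
Hypothesis hv : forall x, 0 <= v x.
Hypothesis hdrift : forall x,
  (kernel_sum P [set: S] v x <= (v x - q x + c * (x \in K)%:R)%:E)%E.

Local Notation A' := (A `\` K)%fset.
Local Notation Kt := (K `\ z)%fset.

(** The expectation from [x] of the cost accumulated at the times [j < n]
    preceding the return to [z]. *)
Definition truncated_cost n x : \bar R :=
  (\sum_(0 <= j < n) iter j (kernel_op P [set~ z]) (EFin \o q) x)%E.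

Local Notation W := truncated_cost.

Let iter_ge0 j x : (0 <= iter j (kernel_op P [set~ z]) (EFin \o q) x)%E.
Proof.
elim: j x => [|j IH] x /=; first by rewrite lee_fin.
by apply: esum_ge0 => y _; rewrite mule_ge0 ?lee_fin.
Qed.

Lemma truncated_cost_ge0 n x : (0 <= W n x)%E.
Proof. by apply: sume_ge0. Qed.

Lemma truncated_cost_le n x : (W n x <= W n.+1 x)%E.
Proof. by rewrite /W big_nat_recr //= leeDl. Qed.

Lemma truncated_costS n x :
  (W n.+1 x = (q x)%:E + kernel_op P [set~ z] (W n) x)%E.
Proof.
rewrite /W big_nat_recl //=; congr (_ + _)%E.
rewrite /kernel_op; under [RHS]eq_esum do rewrite ge0_sume_distrr //.
by rewrite esum_sum // => y j _ _; rewrite mule_ge0 ?lee_fin.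
Qed.

Lemma drift_step n a x : 0 <= a ->
  (forall y, y != z -> (W n y <= (v y + a)%:E)%E) ->
  (W n.+1 x <= (v x + c * (x \in K)%:R + a)%:E)%E.
Proof.
move=> a0 Wle; rewrite truncated_costS.
have := @kernel_op_le_affine setT ((W n) \_ [set~ z]) v a x a0 hv.
rewrite -kernel_op_nz; last exact: truncated_cost_ge0.
case: sP => _ ->; rewrite mule1 => /(_ _)/le_trans le_op.
apply: (@le_trans _ _ ((q x)%:E + ((v x - q x + c * (x \in K)%:R)%:E + a%:E))%E).
  rewrite leeD2l // le_op //; last by rewrite leeD2r.
  move=> y _; rewrite patchE; case: ifPn => [|_]; last by rewrite lee_fin addr_ge0.
  by rewrite inE => /eqP; exact: Wle.
by rewrite -!EFinD lee_fin; lra.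
Qed.

Lemma truncated_cost_le_drift n x : (W n x <= (v x + n%:R * `|c|)%:E)%E.
Proof.
elim: n x => [|n IH] x; first by rewrite /W big_nil mul0r addr0 lee_fin.
apply: (le_trans (@drift_step n (n%:R * `|c|) x _ _)) => //.
rewrite lee_fin -addrA lerD2l -natr1 mulrDl mul1r addrC lerD2l.
by case: (x \in K); rewrite ?mulr1 ?mulr0 ?ler_norm.
Qed.

Lemma truncated_cost_fin n x : W n x \is a fin_num.
Proof.
rewrite ge0_fin_numE ?truncated_cost_ge0 //.
exact: le_lt_trans (truncated_cost_le_drift n x) (ltry _).
Qed.

(** Outside [z], a bound [a] for the truncated cost on [K - {z}] propagates to
    [v + a]: off [K] the drift condition says that [v] pays for the cost up to
    the hitting time of [K]. *)
Lemma truncated_cost_le_off n a : 0 <= a ->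
  (forall y, y \in Kt -> (W n y <= a%:E)%E) ->
  forall y, y != z -> (W n y <= (v y + a)%:E)%E.
Proof.
move=> a0; elim: n => [|n IH] Wa y yz.
  by rewrite /W big_nil lee_fin addr_ge0.
have [yK|yK] := boolP (y \in K).
  apply: (le_trans (Wa _ _)); first by rewrite !inE yz.
  by rewrite lee_fin lerDr.
apply: (le_trans (@drift_step n a y a0 _)).
  by apply: IH => t tK; rewrite (le_trans _ (Wa _ tK)) // truncated_cost_le.
by rewrite (negPf yK) mulr0 addr0.
Qed.

Let WE n x : W n x = (fine (W n x))%:E.
Proof. by rewrite fineK // truncated_cost_fin. Qed.

Let zA : z \in A. Proof. exact: (fsubsetP KA). Qed.

Let sum_Az n x : (\sum_(y <- (A `\ z)%fset) (P x y)%:E * W n y =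
  (\sum_(y <- Kt) P x y * fine (W n y) + \sum_(a <- A') P x a * fine (W n a))%:E)%E.
Proof.
rewrite -(sum_Az_split KA zK (fun y => P x y * fine (W n y))) -sumEFin.
by apply: eq_bigr => y _; rewrite WE EFinM.
Qed.

(** The drift condition makes the sum defining [Pv3] finite. *)
Lemma Pv3E x : (kernel_sum P [set y | y \notin A] v x = (Pv3 P A v x)%:E)%E.
Proof.
rewrite fineK // ge0_fin_numE; last first.
  by apply: esum_ge0 => y _; rewrite lee_fin mulr_ge0.
apply: le_lt_trans (ltry (v x - q x + c * (x \in K)%:R)).
apply: le_trans (hdrift x); rewrite /kernel_sum [leLHS]esum_mkcond.
by apply: le_esum => y _; case: ifP => _; rewrite lee_fin // mulr_ge0.
Qed.

(** The cost accumulated after leaving [A] is bounded by [v] at the exit point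
    plus [m]. *)
Lemma truncated_cost_sub n m x : 0 <= m ->
  (forall y, y \in Kt -> fine (W n y) <= m) ->
  fine (W n x) <= q x + Pv3 P A v x + m * exit_prob P A x
    + \sum_(y <- Kt) P x y * fine (W n y)
    + \sum_(a <- A') P x a * fine (W n a).
Proof.
move=> m0 fm; rewrite -lee_fin -WE (le_trans (truncated_cost_le n x)) //.
rewrite truncated_costS (kernel_op_split _ (A := A)) //; last first.
  exact: truncated_cost_ge0.
have le_op := @kernel_op_le_affine [set y | y \notin A] (W n) v m x m0 hv.
apply: (@le_trans _ _ ((q x)%:E + ((\sum_(y <- Kt) P x y * fine (W n y) +
    \sum_(a <- A') P x a * fine (W n a))%:E + (Pv3 P A v x + m * exit_prob P A x)%:E))%E).
  rewrite leeD2l // sum_Az leeD2l // EFinD EFinM -Pv3E -esum_exit_prob.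
  apply: le_op => y /= yA; apply: truncated_cost_le_off => //.
    by move=> t tK; rewrite WE lee_fin fm.
  by apply: contraNneq yA => ->.
by rewrite -!EFinD lee_fin; lra.
Qed.

(** The converse inequality for the chain killed when it leaves [A]. *)
Lemma truncated_cost_super n x :
  q x + \sum_(y <- Kt) P x y * fine (W n y)
    + \sum_(a <- A') P x a * fine (W n a) <= fine (W n.+1 x).
Proof.
rewrite -lee_fin -WE truncated_costS (kernel_op_split _ (A := A)) //; last first.
  exact: truncated_cost_ge0.
rewrite sum_Az -addrA EFinD leeD2l // leeDl //.
by apply: esum_ge0 => y _; rewrite mule_ge0 ?lee_fin ?truncated_cost_ge0.
Qed.

Hypothesis MP_A' : max_principle A' P.
Hypothesis MP_Az : max_principle (A `\ z)%fset P.

Lemma truncated_cost_le_kappa_upper n x : norm_Ginv_xi P K z A < 1 ->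
  x \in (A `\ z)%fset -> (W n x <= (kappa_upper P K z A q v x)%:E)%E.
Proof.
move=> xi1 xA; rewrite WE lee_fin.
pose m := \big[Num.max/0]_(y <- Kt) (fine \o W n) y.
have m0 : 0 <= m by exact: bigmax_ge_id.
have fm y : y \in Kt -> (fine \o W n) y <= m.
  by move=> yK; exact: (le_bigmax_seq 0 y xpredT _ yK isT).
apply: (@le_kappa_upper _ _ P K z A q v P_ge0 KA zK MP_A' MP_Az (fine \o W n) m) => //.
- by move=> y _; exact: exit_prob_ge0.
- by move=> m' m'0 fm'; rewrite /m big_seq; apply: bigmax_le.
- by move=> y yA; exact: truncated_cost_sub.
Qed.

End Drift.

End TruncationBounds.

(** * The two bounds *)

Lemma cvg_sum_mulr (R : realType) (I : eqType) (r : seq I) (a : I -> R)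
    (u : nat -> I -> R) (l : I -> R) :
  (forall i, i \in r -> u n i @[n --> \oo] --> l i) ->
  \sum_(i <- r) a i * u n i @[n --> \oo] --> \sum_(i <- r) a i * l i.
Proof.
elim: r => [|i r IH] ul.
  under eq_cvg do rewrite big_nil.
  by rewrite big_nil; exact: cvg_cst.
under eq_cvg do rewrite big_cons.
rewrite big_cons; apply: cvgD; last by apply: IH => j jr; apply: ul; rewrite inE jr orbT.
by apply: cvgMl_tmp; apply: ul; rewrite inE eqxx.
Qed.

Theorem theorem1 (R : realType) (S : countType) (P : S -> S -> R)
    (d : measure_display) (Omega : measurableType d)
    (Pr : S -> probability Omega R) (X : nat -> Omega -> S)
    (K : {fset S}) (z : S) (A : {fset S}) (q v : S -> R) (c : R)
    (hX : markov_chain P Pr X)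
    (hirr : irreducible_chain Pr X)
    (hrec : recurrent_chain Pr X)
    (hz : z \in K)
    (hKA : (K `<=` A)%fset)
    (hq : forall x, 0 <= q x)
    (hv : forall x, 0 <= v x)
    (hdrift : forall x,
      (kernel_sum P [set: S] v x <=
         (v x - q x + c * (x \in K)%:R)%:E)%E)
    (hxi : norm_Ginv_xi P K z A < 1) :
  forall x, x \in A -> x != z ->
    ((kappa_lower P K z A q x)%:E <= expected_cost Pr X z q x)%E /\
    (expected_cost Pr X z q x <= (kappa_upper P K z A q v x)%:E)%E.
Proof.
have sP := mc_stochastic hX; have P_ge0 : forall x y, 0 <= P x y by case: sP.
have MP_A' : max_principle (A `\` K)%fset P.
  by apply: (max_principle_irreducible sP hX hirr (z := z)); rewrite inE hz.
have MP_Az : max_principle (A `\ z)%fset P.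
  by apply: (max_principle_irreducible sP hX hirr (z := z)); rewrite !inE eqxx.
pose W := truncated_cost P z q.
pose w := expected_cost Pr X z q.
have W_ge0 n x : (0 <= W n x)%E by exact: truncated_cost_ge0.
have WE n x : W n x = (fine (W n x))%:E.
  by rewrite fineK //; exact: (truncated_cost_fin sP z hq hv hdrift).
have iter_ge0 j x : (0 <= iter j (kernel_op P [set~ z]) (EFin \o q) x)%E.
  elim: j x => [|j IH] x /=; first by rewrite lee_fin.
  exact: (kernel_op_ge0 hX).
have W_cvg x : W n x @[n --> \oo] --> w x.
  rewrite /w (expected_cost_series hX) //.
  by apply: is_cvg_nneseries => n _ _; exact: iter_ge0.
have W_le n x : (W n x <= w x)%E.
  rewrite /w (expected_cost_series hX) //.
  by apply: nneseries_lim_ge => j _ _; exact: iter_ge0.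
have w_upper x : x \in (A `\ z)%fset -> (w x <= (kappa_upper P K z A q v x)%:E)%E.
  move=> xA; rewrite -(cvg_lim _ (W_cvg x)) //.
  apply: lime_le; first by apply/cvg_ex; exists (w x).
  by apply: nearW => n; exact: (truncated_cost_le_kappa_upper sP hz hKA hq hv hdrift).
have w_fin x : x \in (A `\ z)%fset -> w x = (fine (w x))%:E.
  move=> xA; rewrite fineK // ge0_fin_numE.
    exact: le_lt_trans (w_upper x xA) (ltry _).
  exact: le_trans (W_ge0 0%N x) (W_le 0%N x).
move=> x xA xz; have {xz}xA : x \in (A `\ z)%fset by rewrite !inE xz.
split; last exact: w_upper.
rewrite -/(w x) w_fin // lee_fin.
apply: (kappa_lower_le P_ge0 hKA hz MP_A' MP_Az (f := fine \o w)) => //= y yA.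
have fW_cvg t : t \in (A `\ z)%fset -> fine (W n t) @[n --> \oo] --> fine (w t).
  by move=> tA; apply: fine_cvg; rewrite -w_fin.
(* The first-step inequality for [W n] passes to the limit in [n]. *)
pose g n := q y + \sum_(t <- (K `\ z)%fset) P y t * fine (W n t)
  + \sum_(t <- (A `\` K)%fset) P y t * fine (W n t).
have g_cvg : g n @[n --> \oo] --> q y + \sum_(t <- (K `\ z)%fset) P y t * fine (w t)
  + \sum_(t <- (A `\` K)%fset) P y t * fine (w t).
  apply: cvgD; first apply: cvgD; first exact: cvg_cst.
    apply: cvg_sum_mulr => t; rewrite !inE => /andP[tz /(fsubsetP hKA) tA].
    by apply: fW_cvg; rewrite !inE tz.
  apply: cvg_sum_mulr => t; rewrite !inE => /andP[tK tA].
  by apply: fW_cvg; rewrite !inE tA andbT; apply: contraNneq tK => ->.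
rewrite -(cvg_lim _ g_cvg) //.
apply: limr_le; first by apply/cvg_ex; eexists; exact: g_cvg.
apply: nearW => n; apply: (le_trans (truncated_cost_super sP hz hKA hq hv hdrift n y)).
by rewrite -lee_fin -w_fin // -WE.
Qed.
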